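(* Let $\mathfrak{g}=\mathfrak{q}(N)$, let $\chi\in\mathfrak{g}_{\bar 0}^*$ be a nilpotent linear functional, extended to $\mathfrak{g}$ by $\chi(\mathfrak{g}_{\bar 1})=0$, let $E\in\mathfrak{g}_{\bar 1}$ be the element with $\chi=(E,\cdot)$ and let $e=\Pi(E)\in\mathfrak{g}_{\bar 0}=\mathfrak{gl}(N)$. A $\mathbb{Z}$-grading $\Gamma:\ \mathfrak{g}=\bigoplus_{j\in\mathbb{Z}}\mathfrak{g}_j$ is good for $\chi$ if and only if its restriction $\mathfrak{g}_{\bar 0}=\bigoplus_{j\in\mathbb{Z}}\mathfrak{g}_{j,\bar 0}$ to $\mathfrak{g}_{\bar 0}$ is a good grading for $e$ of the Lie algebra $\mathfrak{g}_{\bar 0}=\mathfrak{gl}(N)$.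
   Context: The ground field is $\mathbb{C}$; subspaces are $\mathbb{Z}_2$-graded. The queer Lie superalgebra $\mathfrak{g}=\mathfrak{q}(N)$ consists of all matrices $\begin{pmatrix} S & S'\\ S' & S\end{pmatrix}$ with $S,S'$ complex $N\times N$ matrices; such an element is even if $S'=0$ and odd if $S=0$; the bracket is the supercommutator of matrices. The even part is identified with $\mathfrak{gl}(N)$ via $S$. The linear map $\Pi:\mathfrak{g}\to\mathfrak{g}$ interchanges the roles of $S$ and $S'$ (parity swapping). The form $(x,y)=\mathrm{otr}(xy)$, where $\mathrm{otr}\begin{pmatrix} A & B \\ B & A \end{pmatrix}=\mathrm{trace}(B)$, is an odd nondegenerate invariant supersymmetric bilinear form on $\mathfrak{g}$. A functional $\chi\in\mathfrak{g}_{\bar 0}^*$ is nilpotent if, extended by zero to $\mathfrak{g}_{\bar1}$ and written $\chi=(E,\cdot)$ with $E\in\mathfrak{g}_{\bar 1}$, the matrix $e=\Pi(E)\in\mathfrak{gl}(N)$ is nilpotent. Put $\mathfrak{g}_\chi=\{y\in\mathfrak{g}: \chi([y,\mathfrak{g}])=0\}$. A $\mathbb{Z}$-grading of $\mathfrak{g}$ is a decomposition $\mathfrak{g}=\bigoplus_{j\in\mathbb{Z}}\mathfrak{g}_j$ with $\mathfrak{g}_j=\mathfrak{g}_{j,\bar0}\oplus\mathfrak{g}_{j,\bar1}$ (where $\mathfrak{g}_{j,\epsilon}=\mathfrak{g}_j\cap\mathfrak{g}_\epsilon$) and $[\mathfrak{g}_i,\mathfrak{g}_j]\subseteq\mathfrak{g}_{i+j}$.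 It is good for $\chi$ if the center $\mathfrak{z}(\mathfrak{g})$ (the scalar matrices) is contained in $\mathfrak{g}_0$, $\chi(\mathfrak{g}_j)=0$ for all $j\neq-2$, and $\mathfrak{g}_\chi\subseteq\bigoplus_{j\ge0}\mathfrak{g}_j$. A $\mathbb{Z}$-grading $\mathfrak{gl}(N)=\bigoplus_j\mathfrak{gl}(N)_j$ of the Lie algebra $\mathfrak{gl}(N)$ is good for a nilpotent $e$ if the center of $\mathfrak{gl}(N)$ lies in degree $0$, $e\in\mathfrak{gl}(N)_2$, and the centralizer of $e$ in $\mathfrak{gl}(N)$ is contained in $\bigoplus_{j\ge0}\mathfrak{gl}(N)_j$. *)

(* Defs.v *)
From HB Require Import structures.
From mathcomp Require Import all_boot all_order all_algebra.
From mathcomp Require Export reals complex.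

Set Implicit Arguments.
Unset Strict Implicit.
Unset Printing Implicit Defensive.

Import GRing.Theory.
Local Open Scope ring_scope.

Section Gradings.
Variables (F : fieldType) (V : vectType F).
Implicit Types (g : {vspace V}) (G : int -> {vspace V}) (br : V -> V -> V).

Definition mem_sum_deg G (P : pred int) (x : V) : Prop :=
  exists (s : seq int) (u : int -> V),
    [/\ all P s, forall j, u j \in G j & x = \sum_(j <- s) u j].

Definition direct_decomposition g G : Prop :=
  [/\ forall j, (G j <= g)%VS,
      forall x, x \in g -> mem_sum_deg G predT x
    & forall (s : seq int) (u : int -> V),
        uniq s -> (forall j, u j \in G j) -> \sum_(j <- s) u j = 0 ->
        forall j, j \in s -> u j = 0].

Definition zgrading br g G : Prop :=
  direct_decomposition g G /\
  (forall i j x y, x \in G i -> y \in G j -> br x y \in G (i + j)).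

Definition in_center br g (z : V) : Prop :=
  z \in g /\ forall x, x \in g -> br z x = 0.

End Gradings.

Section GL.
Variables (F : fieldType) (N : nat).
Implicit Types (A B e : 'M[F]_N) (G : int -> {vspace 'M[F]_N}).

Definition gl_bracket A B : 'M[F]_N := A *m B - B *m A.

Definition nilpotent_mx A : Prop := exists k : nat, A ^+ k = 0.

Definition gl_good_grading e G : Prop :=
  [/\ zgrading gl_bracket fullv G,
      forall z, in_center gl_bracket fullv z -> z \in G 0,
      e \in G 2
    & forall y, gl_bracket e y = 0 -> mem_sum_deg G (fun j => 0 <= j) y].

End GL.

Section Queer.
Variables (F : fieldType) (N : nat).
Notation V := 'M[F]_(N + N).
Implicit Types (x y E : V) (G : int -> {vspace V}) (chi : {scalar 'M[F]_N}).

Definition queer_mx (p : 'M[F]_N * 'M[F]_N) : V := block_mx p.1 p.2 p.2 p.1.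

Fact queer_mx_is_linear : linear queer_mx.
Proof.
by move=> a p q; rewrite /queer_mx scale_block_mx add_block_mx.
Qed.

HB.instance Definition _ :=
  GRing.isLinear.Build F ('M[F]_N * 'M[F]_N)%type V _ queer_mx
    queer_mx_is_linear.

Definition queer : {vspace V} := limg (linfun queer_mx).

Lemma mem_queerP x :
  reflect (exists S S' : 'M[F]_N, x = block_mx S S' S' S) (x \in queer).
Proof.
apply: (iffP memv_imgP) => [[p _ ->]|[S [S' ->]]].
  by exists p.1, p.2; rewrite lfunE.
by exists (S, S'); rewrite ?memvf ?lfunE.
Qed.

(* Components in gl(N|N); [true] stands for odd. *)
Definition parity_part (b : bool) x : V :=
  if b then block_mx 0 (ursubmx x) (dlsubmx x) 0
  else block_mx (ulsubmx x) 0 0 (drsubmx x).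

Fact parity_part_is_linear b : linear (parity_part b).
Proof.
move=> a x y; rewrite -[x]submxK -[y]submxK /parity_part; case: b;
  rewrite !(scale_block_mx, add_block_mx);
  by rewrite !(block_mxKul, block_mxKur, block_mxKdl, block_mxKdr) scaler0 addr0.
Qed.

HB.instance Definition _ b :=
  GRing.isLinear.Build F V V _ (parity_part b) (parity_part_is_linear b).

Definition queer_par (b : bool) : {vspace V} :=
  (queer :&: lker (linfun (parity_part (~~ b))))%VS.

Lemma mem_queer_evenP x :
  reflect (exists S : 'M[F]_N, x = block_mx S 0 0 S) (x \in queer_par false).
Proof.
rewrite memv_cap memv_ker lfunE /=.
apply: (iffP andP) => [[/mem_queerP[S [S' ->]]]|[S ->]].
  rewrite block_mxKur block_mxKdl -block_mx0 => /eqP/eq_block_mx[_ -> _ _].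
  by exists S.
split; first by apply/mem_queerP; exists S, 0.
by rewrite block_mxKur block_mxKdl block_mx0.
Qed.

Lemma mem_queer_oddP x :
  reflect (exists S' : 'M[F]_N, x = block_mx 0 S' S' 0) (x \in queer_par true).
Proof.
rewrite memv_cap memv_ker lfunE /=.
apply: (iffP andP) => [[/mem_queerP[S [S' ->]]]|[S' ->]].
  rewrite block_mxKul block_mxKdr -block_mx0 => /eqP/eq_block_mx[-> _ _ _].
  by exists S'.
split; first by apply/mem_queerP; exists 0, S'.
by rewrite block_mxKul block_mxKdr block_mx0.
Qed.

(* Bilinear extension of [x, y] = xy - (-1)^(|x||y|) yx. *)
Definition superbracket x y : V :=
  \sum_(a : bool) \sum_(b : bool)
    (parity_part a x *m parity_part b y
     - (-1) ^+ (a && b) *: (parity_part b y *m parity_part a x)).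

(* The identification of the even part with gl(N); on all of q(N) it forgets
   the odd component. *)
Definition queer_S x : 'M[F]_N := ulsubmx x.

Fact queer_S_is_linear : linear queer_S.
Proof. by move=> a x y; apply/matrixP=> i j; rewrite !mxE. Qed.

HB.instance Definition _ :=
  GRing.isLinear.Build F V 'M[F]_N _ queer_S queer_S_is_linear.

Definition parity_swap x : V :=
  block_mx (ursubmx x) (ulsubmx x) (ulsubmx x) (ursubmx x).

Definition otr x : F := \tr (ursubmx x).

Definition queer_form x y : F := otr (x *m y).

(* Extension by zero of a functional on gl(N) = q(N)_0. *)
Definition chi_ext chi x : F := chi (queer_S x).

Definition represents E chi : Prop :=
  E \in queer_par true /\ forall x, x \in queer -> chi_ext chi x = queer_form E x.

Definition nilpotent_functional chi : Prop :=
  exists E, represents E chi /\ nilpotent_mx (queer_S (parity_swap E)).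

Definition queer_grading G : Prop :=
  zgrading superbracket queer G /\
  (forall j, G j = (G j :&: queer_par false + G j :&: queer_par true)%VS).

Definition stabilizer chi y : Prop :=
  y \in queer /\ forall x, x \in queer -> chi_ext chi (superbracket y x) = 0.

Definition queer_good_grading chi G : Prop :=
  [/\ queer_grading G,
      forall z, in_center superbracket queer z -> z \in G 0,
      forall j, j != - 2 -> forall x, x \in G j -> chi_ext chi x = 0
    & forall y, stabilizer chi y -> mem_sum_deg G (fun j => 0 <= j) y].

Definition even_restriction G (j : int) : {vspace 'M[F]_N} :=
  (linfun queer_S @: (G j :&: queer_par false))%VS.

Lemma mem_even_restriction G j A :
  (A \in even_restriction G j) = (block_mx A 0 0 A \in G j).
Proof.
apply/memv_imgP/idP => [[x] | GA].
  rewrite memv_cap => /andP[Gx /mem_queer_evenP[S def_x]].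
  by rewrite lfunE /= def_x /queer_S block_mxKul => ->; rewrite -def_x.
exists (block_mx A 0 0 A); last by rewrite lfunE /= /queer_S block_mxKul.
by rewrite memv_cap GA; apply/mem_queer_evenP; exists A.
Qed.

End Queer.

(* Main.v *)
From HB Require Import structures.
Require Import Defs.
From mathcomp Require Import all_boot all_order all_algebra.

Set Implicit Arguments.
Unset Strict Implicit.
Unset Printing Implicit Defensive.

Import Order.TTheory GRing.Theory Num.Theory.
Local Open Scope ring_scope.

(** A grading of q(N) for which the identity matrix has degree 0 is an
    associative grading of gl(N) taken twice, once for each parity, and the
    identification of the odd part with gl(N) preserves degrees.  Indeed the odd
    copy 1' of the identity commutes with the even part, so each homogeneous
    component of 1' is a scalar multiple of 1'; hence 1' is itself homogeneous,
    and since [1', 1'] = 2 has degree 0, so does 1' ([odd_identity_degree0]).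
    Then [1', B'] = 2 B compares the degrees of the two copies of B, and adding
    [A, B] = AB - BA to [A', B'] = AB + BA shows that the associative product AB
    respects degrees ([even_associative_grading]).

    With chi = tr (e _), the stabilizer of chi consists of the elements whose
    even part commutes with e and whose odd part anticommutes with e
    ([stabilizerP]).  The two notions of goodness therefore differ in two
    points only.

    The first is that chi lives in degree -2 exactly when e has degree 2.  This
    holds because products of matrices of degrees i and j with i + j nonzero
    have trace 0 ([mxtrace_homogeneous]) and the trace form is nondegenerate.

    The second is that the matrices anticommuting with e have nonnegative
    degrees as soon as those commuting with e do ([anticommutant_nonneg]).  For
    w nonzero, multiplying the part of degree j by w ^ j is an automorphism of
    the matrix algebra, hence inner, by Skolem and Noether: there is an
    invertible s with s A = w ^ j A s for all A of degree j ([exists_twist]),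
    and s has degree 0 ([twists_degree0]).  When w ^ 2 = -1 this s anticommutes
    with e, which has degree 2, so A |-> s A takes matrices anticommuting with e
    to matrices commuting with e, without changing degrees.

    The twist with w = 2 gives the trace statement: a matrix A of degree k is
    conjugate to 2 ^ k A.  Comparing determinants instead, an invertible
    homogeneous matrix has degree 0, which is how the degree of s is found. *)

(** * Projections onto the homogeneous components *)

Section GradedProjections.
Variables (F : fieldType) (V : vectType F).
Implicit Types (g : {vspace V}) (G : int -> {vspace V}) (P : pred int).

(** Outside [g] the maps [p j] depend on a choice of complements in the ambient
    space; only the degree of their values is prescribed there. *)
Definition graded_projections g G (S : seq int) (p : int -> 'End(V)) : Prop :=
  [/\ forall j x, p j x \in G j,
      forall x, x \in g -> x = \sum_(j <- S) p j x
    & forall j k x, x \in G j -> p k x = if k == j then x else 0].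

Lemma memv_sum_seq (S : seq int) G (u : int -> V) :
  (forall j, j \in S -> u j \in G j) ->
  \sum_(j <- S) u j \in (\sum_(j <- S) G j)%VS.
Proof.
elim: S => [|j S IHS] Gu; first by rewrite !big_nil mem0v.
rewrite !big_cons memv_add ?Gu ?mem_head //.
by apply: IHS => k Sk; rewrite Gu // in_cons Sk orbT.
Qed.

Lemma sumv_seq_sup (S : seq int) G j : j \in S -> (G j <= \sum_(k <- S) G k)%VS.
Proof.
elim: S => //= k S IHS; rewrite in_cons big_cons.
case/predU1P=> [<-|/IHS sGjS]; first exact: addvSl.
exact: subv_trans sGjS (addvSr _ _).
Qed.

Lemma sumv_seq_subset (S T : seq int) G :
  {subset S <= T} -> (\sum_(j <- S) G j <= \sum_(j <- T) G j)%VS.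
Proof.
elim: S => [|j S IHS] sST; first by rewrite big_nil sub0v.
rewrite big_cons subv_add sumv_seq_sup ?sST ?mem_head //=.
by apply: IHS => k Sk; rewrite sST // in_cons Sk orbT.
Qed.

(** The degrees occurring in the decompositions of the vectors of one basis of
    [g] suffice for every vector of [g]. *)
Lemma finite_degree_support g G :
  direct_decomposition g G -> exists2 S, uniq S & g = (\sum_(j <- S) G j)%VS.
Proof.
case=> sGg decG _.
have supp (X : seq V) : {subset X <= g} ->
    exists S, {subset X <= (\sum_(j <- S) G j)%VS}.
  elim: X => [|x X IHX] sXg; first by exists [::].
  have [|S sXS] := IHX; first by move=> y Xy; rewrite sXg // in_cons Xy orbT.
  have [s [u [_ Gu x_sum]]] := decG x (sXg x (mem_head x X)).
  exists (s ++ S) => y; rewrite in_cons => /predU1P[->|/sXS Sy].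
    rewrite x_sum; have := memv_sum_seq (fun j (_ : j \in s) => Gu j).
    apply: (subvP _).
    by apply: sumv_seq_subset => j sj; rewrite mem_cat sj.
  apply: subvP y Sy; apply: sumv_seq_subset => j Sj.
  by rewrite mem_cat Sj orbT.
have [S sXS] := supp (vbasis g) (fun x => @vbasis_mem _ _ x g).
exists (undup S); first exact: undup_uniq.
apply/eqP; rewrite eqEsubv; apply/andP; split.
  rewrite -(span_basis (vbasisP g)); apply/span_subvP=> x /sXS.
  by apply: subvP x; apply: sumv_seq_subset => j; rewrite mem_undup.
elim: (undup S) => [|j T IHT]; first by rewrite big_nil sub0v.
by rewrite big_cons subv_add sGg.
Qed.

(** Extending by zero the projections attached to the finite sum of
    [finite_degree_support] makes them available in every degree. *)
Lemma exists_graded_projections g G :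
  direct_decomposition g G -> exists S p, graded_projections g G S p.
Proof.
move=> decG; have [S uS defg] := finite_degree_support decG.
case: decG => sGg _ indG.
pose p j : 'End(V) := if j \in S then sumv_pi_for defg j else 0%VF.
have Gp j x : p j x \in G j.
  by rewrite /p; case: ifP => _; rewrite ?memv_sum_pi // lfunE mem0v.
have sum_p x : x \in g -> x = \sum_(j <- S) p j x.
  move=> gx; rewrite -[LHS](sumv_pi_uniq_sum defg) ?filter_predT //.
  by apply: eq_big_seq => j Sj; rewrite /p Sj.
exists S, p; split=> // j k x Gx.
(* The degrees j and k are added because neither has to occur in S. *)
pose T := undup [:: j, k & S]; pose w i := p i x - (if i == j then x else 0).
have p0 i : i \notin S -> p i x = 0.
  by rewrite /p => /negPf->; rewrite lfunE.
have sum_T : \sum_(i <- T) p i x = x.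
  rewrite {2}[x]sum_p ?(subvP (sGg j)) // [LHS](bigID [in S]) /=.
  rewrite [X in _ + X]big1 ?addr0 => [|i /p0 //].
  rewrite -big_filter; apply: perm_big; apply: uniq_perm => //.
    by rewrite filter_uniq ?undup_uniq.
  move=> i; rewrite mem_filter mem_undup !in_cons.
  by case: (i \in S); rewrite ?orbT.
have w0 : \sum_(i <- T) w i = 0.
  rewrite sumrB sum_T; apply/eqP; rewrite subr_eq0 eq_sym.
  rewrite (bigD1_seq j) ?undup_uniq ?mem_undup ?mem_head //= eqxx.
  by rewrite big1 ?addr0 // => i /negPf->.
have Gw i : w i \in G i.
  by rewrite rpredB ?Gp //; have [->|_] := eqVneq i j; rewrite ?mem0v.
have Tk : k \in T by rewrite mem_undup !in_cons eqxx orbT.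
by apply/eqP; rewrite -subr_eq0; apply/eqP/(indG T w (undup_uniq _) Gw w0 k Tk).
Qed.

Section Components.
Variables (g : {vspace V}) (G : int -> {vspace V}) (S : seq int).
Variable p : int -> 'End(V).
Hypothesis pG : graded_projections g G S p.

Lemma proj_mem j x : p j x \in G j.
Proof. by case: pG. Qed.

Lemma sum_proj x : x \in g -> x = \sum_(j <- S) p j x.
Proof. by case: pG => _ + _; apply. Qed.

Lemma proj_id j x : x \in G j -> p j x = x.
Proof. by case: pG => _ _ /[apply]->; rewrite eqxx. Qed.

Lemma proj_neq j k x : x \in G j -> k != j -> p k x = 0.
Proof. by case: pG => _ _ /[apply]-> /negPf->. Qed.

Lemma graded_disjoint j k x : x \in G j -> x \in G k -> x != 0 -> j = k.
Proof.
move=> Gjx Gkx nz_x; apply: contraNeq nz_x => neq_jk.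
by rewrite -(proj_id Gjx) (proj_neq Gkx).
Qed.

Lemma mem_degree_eq0 k x :
  x \in g -> (forall j, j != k -> p j x = 0) -> x \in G k.
Proof.
move=> gx p0; rewrite (sum_proj gx); apply: rpred_sum => j _.
by have [->|/p0->] := eqVneq j k; rewrite ?proj_mem ?mem0v.
Qed.

(** Replaces an existential over decompositions, in which a degree may be
    repeated, by linear equations. *)
Lemma mem_sum_degP P x : x \in g ->
  mem_sum_deg G P x <-> (forall j, ~~ P j -> p j x = 0).
Proof.
move=> gx; split=> [[s [u [/allP sP Gu ->]]] j P'j | p0].
  rewrite linear_sum big1_seq // => k /sP Pk; apply: proj_neq (Gu k) _.
  by apply: contraNneq P'j => ->.
exists (filter P S), (fun j => p j x); split=> [|j|]; rewrite ?filter_all //.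
  exact: proj_mem.
rewrite big_filter [LHS](sum_proj gx) [LHS](bigID P) /=.
by rewrite [X in _ + X]big1 ?addr0.
Qed.

End Components.
End GradedProjections.

(** * Homogeneous linear maps *)

Section HomogeneousMaps.
Variables (F : fieldType) (V W : vectType F) (f : {linear V -> W}).
Variables (G : int -> {vspace V}) (H : int -> {vspace W}).

Lemma mem_sum_deg_map P x : (forall j y, y \in G j -> f y \in H j) ->
  mem_sum_deg G P x -> mem_sum_deg H P (f x).
Proof.
move=> fGH [s [u [sP Gu ->]]]; exists s, (f \o u); split=> // [j|].
  exact: fGH.
exact: linear_sum.
Qed.

(** The workhorse for homogeneous components of products and brackets: a linear
    map of degree [d] intertwines the projections, up to the shift by [d]. *)
Lemma proj_homogeneous g h S T (p : int -> 'End(V)) (q : int -> 'End(W)) d k x :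
    graded_projections g G S p -> graded_projections h H T q ->
    (forall j y, y \in G j -> f y \in H (d + j)) -> x \in g ->
  q (d + k) (f x) = f (p k x).
Proof.
move=> pG qH fGH gx; rewrite (sum_proj pG gx) !linear_sum.
apply: eq_bigr => j _ /=; have Gj := proj_mem pG j x.
have [->|neq_kj] := eqVneq k j.
  by rewrite (proj_id pG Gj) (proj_id qH (fGH _ _ Gj)).
rewrite (proj_neq pG Gj neq_kj) linear0 (proj_neq qH (fGH _ _ Gj)) //.
by rewrite (inj_eq (addrI d)).
Qed.

End HomogeneousMaps.

Lemma mem_sum_degD (F : fieldType) (V : vectType F) (g : {vspace V}) G P x y :
    direct_decomposition g G -> x \in g -> y \in g ->
  mem_sum_deg G P x -> mem_sum_deg G P y -> mem_sum_deg G P (x + y).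
Proof.
move=> /exists_graded_projections[S [p pG]] gx gy.
rewrite !(mem_sum_degP pG) ?rpredD // => px0 py0 j P'j.
by rewrite linearD /= px0 ?py0 ?addr0.
Qed.

(** * Matrices *)

Section ElementaryMatrices.
Variables (F : fieldType) (N : nat).
Implicit Types (A B s : 'M[F]_N) (i r k c : 'I_N).

Lemma delta_mulmxE i r A k c : (delta_mx i r *m A) k c = A r c *+ (k == i).
Proof.
rewrite mxE (bigD1 r) //= big1 => [|l /negPf neq_lr]; last first.
  by rewrite mxE neq_lr andbF mul0r.
by rewrite mxE eqxx andbT addr0 mulr_natl.
Qed.

Lemma mulmx_deltaE A i r k c : (A *m delta_mx i r) k c = A k i *+ (c == r).
Proof.
rewrite mxE (bigD1 i) //= big1 => [|l /negPf neq_li]; last first.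
  by rewrite mxE neq_li mulr0.
by rewrite mxE eqxx addr0 mulr_natr.
Qed.

Lemma delta_mulmx_sum i r A :
  delta_mx i r *m A = \sum_k A r k *: delta_mx i k.
Proof.
apply/matrixP=> a c; rewrite delta_mulmxE summxE (bigD1 c) //= big1.
  by rewrite !mxE eqxx andbT addr0 mulr_natr.
by move=> k neq_kc; rewrite !mxE [c == k]eq_sym (negPf neq_kc) andbF mulr0.
Qed.

Lemma mulmx_delta_sum A i r :
  A *m delta_mx i r = \sum_k A k i *: delta_mx k r.
Proof.
apply/matrixP=> a c; rewrite mulmx_deltaE summxE (bigD1 a) //= big1.
  by rewrite !mxE eqxx addr0 mulr_natr.
by move=> k neq_ka; rewrite !mxE [a == k]eq_sym (negPf neq_ka) mulr0.
Qed.

End ElementaryMatrices.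

Section MatrixFacts.
Variables (F : fieldType) (N : nat).
Implicit Types A B s : 'M[F]_N.

Lemma commutes_scalar A : (forall B, A *m B = B *m A) -> exists a, A = a%:M.
Proof.
case: N A => [|n] A comA; first by exists 0; rewrite [LHS]thinmx0 [RHS]thinmx0.
exists (A 0 0); apply/matrixP=> i j; rewrite mxE.
have /matrixP/(_ 0 j) := comA (delta_mx 0 i).
by rewrite mulmx_deltaE delta_mulmxE eqxx mulr1n eq_sym => <-.
Qed.

Lemma mxtrace_nondegenerate A : (forall B, \tr (A *m B) = 0) -> A = 0.
Proof.
move=> trA0; apply/matrixP=> i j; rewrite mxE -[RHS](trA0 (delta_mx j i)).
rewrite /mxtrace (bigD1 i) //= big1 ?addr0 => [|k /negPf neq_ki].
  by rewrite mulmx_deltaE eqxx.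
by rewrite mulmx_deltaE neq_ki.
Qed.

(** If [s K = 0] then [s A K = B s K = 0] for every [A], so a nonzero [K] forces
    [s = 0]; the cokernel of [s] serves as [K]. *)
Lemma intertwiner_unit s :
  s != 0 -> (forall A, exists B, s *m A = B *m s) -> s \in unitmx.
Proof.
move=> nz_s twist_s; rewrite -row_full_unit -cokermx_eq0.
apply: contraNT nz_s => /eqP/matrixP nzK; apply/eqP/matrixP=> a i.
rewrite mxE; apply/eqP/negPn/negP => nz_sai; case: nzK => r c.
have [B sAB] := twist_s (delta_mx i r).
have: (s *m delta_mx i r *m cokermx s) a c = 0.
  by rewrite sAB -mulmxA mulmx_coker mulmx0 mxE.
rewrite -mulmxA mxE (bigD1 i) //= big1 ?addr0 => [|k /negPf neq_ki]; last first.
  by rewrite delta_mulmxE neq_ki mulr0.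
rewrite delta_mulmxE eqxx mulr1n => /eqP; rewrite mulf_eq0 (negPf nz_sai).
by move=> /eqP->; rewrite mxE.
Qed.

End MatrixFacts.

(** * Associative gradings of matrix algebras *)

Definition associative_grading (F : fieldType) (N : nat)
    (G : int -> {vspace 'M[F]_N}) : Prop :=
  direct_decomposition fullv G /\
  (forall i j A B, A \in G i -> B \in G j -> A *m B \in G (i + j)).

(** Conjugation by an invertible such [s] is the automorphism multiplying the
    part of degree [j] by [w ^ j]. *)
Definition twists (F : fieldType) (N : nat) (G : int -> {vspace 'M[F]_N})
    (w : F) (s : 'M[F]_N) : Prop :=
  forall j A, A \in G j -> s *m A = w ^ j *: (A *m s).

Section AssociativeGradings.
Variables (F : fieldType) (N : nat) (G : int -> {vspace 'M[F]_N}).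
Hypothesis assocG : associative_grading G.

Lemma twists_unit w s : twists G w s -> s != 0 -> s \in unitmx.
Proof.
move=> tw_s nz_s; apply: intertwiner_unit => // A.
have [S [p pG]] := exists_graded_projections (proj1 assocG).
exists (\sum_(j <- S) w ^ j *: p j A).
rewrite {1}(sum_proj pG (memvf A)) mulmx_sumr mulmx_suml.
by apply: eq_bigr => j _; rewrite (tw_s j) ?(proj_mem pG) // scalemxAl.
Qed.

(** The Skolem-Noether theorem for the automorphism [theta] that multiplies the
    part of degree [j] by [w ^ j].  For any matrix [M], the sum over [i] of the
    [theta (E_io) M E_oi] intertwines [A] and [theta A]; choosing for [M] an
    elementary matrix that meets a nonzero entry of [theta E_oo] makes it
    nonzero, and then it is invertible. *)
Lemma exists_twist (w : F) : w != 0 -> exists2 s, s \in unitmx & twists G w s.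
Proof.
move=> nz_w; have [o _ | I0] := pickP (xpredT : pred 'I_N); last first.
  by exists 1%:M => [|j A _]; [apply: unitmx1 | apply/matrixP=> i; have := I0 i].
have [decG mulG] := assocG.
have [S [p pG]] := exists_graded_projections decG.
pose theta : 'End('M[F]_N) := \sum_(j <- S) w ^ j *: p j.
have thetaE A : theta A = \sum_(j <- S) w ^ j *: p j A.
  by rewrite sum_lfunE; apply: eq_bigr => j _; rewrite scale_lfunE.
have theta_homog j A : A \in G j -> theta A = w ^ j *: A.
  move=> GA; rewrite thetaE [in RHS](sum_proj pG (memvf A)) scaler_sumr.
  apply: eq_bigr => k _; have [->//|neq_kj] := eqVneq k j.
  by rewrite (proj_neq pG GA neq_kj) !scaler0.
have theta_mul j A B : A \in G j -> theta (A *m B) = w ^ j *: (A *m theta B).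
  move=> GA; rewrite [B in LHS](sum_proj pG (memvf B)) [in RHS]thetaE.
  rewrite !mulmx_sumr linear_sum scaler_sumr.
  apply: eq_bigr => k _ /=.
  rewrite (theta_homog (j + k)) ?mulG ?(proj_mem pG) //.
  by rewrite expfzDr // -scalerA -scalemxAr.
have theta_inj A : theta A = 0 -> A = 0.
  move=> thA0; rewrite (sum_proj pG (memvf A)) big1 // => k _.
  have /eqP: p k (theta A) = w ^ k *: p k A.
    rewrite thetaE [A in RHS](sum_proj pG (memvf A)) !linear_sum.
    apply: eq_bigr => l _; rewrite linearZ /=.
    have [->//|neq_kl] := eqVneq k l.
    by rewrite (proj_neq pG (proj_mem pG l A) neq_kl) !scaler0.
  by rewrite thA0 linear0 eq_sym scaler_eq0 expfz_eq0 (negPf nz_w) andbF => /eqP.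
(* The column c of a nonzero entry selects M = E_co below. *)
have [r /existsP[c nz_rc]]: exists r, [exists c, theta (delta_mx o o) r c != 0].
  have nz_th : theta (delta_mx o o) != 0.
    apply/eqP=> /theta_inj/matrixP/(_ o o); rewrite !mxE eqxx => /eqP.
    by rewrite oner_eq0.
  apply/existsP; apply: contraNT nz_th => th0; apply/eqP/matrixP=> r c.
  rewrite mxE; apply/eqP; apply: contraNT th0 => nz_rc.
  by apply/existsP; exists r; apply/existsP; exists c.
pose s : 'M[F]_N := \sum_i theta (delta_mx i o) *m delta_mx c o *m delta_mx o i.
have tw_s : twists G w s.
  move=> j A GA; rewrite /s mulmx_suml mulmx_sumr scaler_sumr.
  (* Both sides expand over the entries of A, the row and column indices
     being summed in opposite orders. *)
  transitivity (\sum_i \sum_k A i k *: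
      (theta (delta_mx i o) *m delta_mx c o *m delta_mx o k)).
    apply: eq_bigr => i _; rewrite -(mulmxA _ _ A) (delta_mulmx_sum _ _ A).
    rewrite mulmx_sumr.
    by apply: eq_bigr => k _; rewrite -scalemxAr.
  rewrite exchange_big; apply: eq_bigr => k _ /=.
  rewrite !mulmxA (scalemxAl _ (A *m _ *m _)) (scalemxAl _ (A *m _)).
  rewrite -(theta_mul j) // (mulmx_delta_sum A) linear_sum.
  rewrite !mulmx_suml; apply: eq_bigr => i _ /=.
  by rewrite linearZ /= -!scalemxAl.
exists s => //; apply: (twists_unit tw_s).
apply: contraNneq nz_rc => s0; have := congr1 (mulmx^~ (delta_mx o o)) s0.
rewrite mul0mx /s mulmx_suml (bigD1 o) //= big1 => [|i neq_io]; last first.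
  by rewrite -(mulmxA _ (delta_mx o i)) mul_delta_mx_0 ?mulmx0.
rewrite addr0 -!mulmxA mul_delta_mx mul_delta_mx => /matrixP/(_ r o).
by rewrite mulmx_deltaE eqxx mulr1n mxE => ->.
Qed.

End AssociativeGradings.

Section AssociativeGradingsInCharacteristicZero.
Variables (F : numFieldType) (N : nat) (G : int -> {vspace 'M[F]_N}).
Hypothesis assocG : associative_grading G.

Let two_neq0 : 2 != 0 :> F. Proof. by rewrite pnatr_eq0. Qed.

(** The twisting relation is homogeneous in [s]. *)
Lemma proj_twists S (p : int -> 'End('M[F]_N)) w s k :
  graded_projections fullv G S p -> twists G w s -> twists G w (p k s).
Proof.
move=> pG tw_s j A GA; have [_ mulG] := assocG.
have pl : p (j + k) (mulmxr A s) = mulmxr A (p k s).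
  apply: (proj_homogeneous k pG pG) (memvf s) => i B GB /=.
  by rewrite addrC mulG.
have pr : p (j + k) (mulmx A s) = A *m p k s.
  apply: (proj_homogeneous k pG pG) (memvf s) => i B GB /=.
  by rewrite mulG.
by rewrite -[LHS]pl /= (tw_s j A GA) linearZ /= pr.
Qed.

(** The twist [s] for [w = 2] gives [s A s^-1 = 2 ^ k A], so [A] and [2 ^ k A]
    have the same trace. *)
Lemma mxtrace_homogeneous k A : A \in G k -> k != 0 -> \tr A = 0.
Proof.
move=> GA nz_k; have [s Us tw_s] := exists_twist assocG two_neq0.
apply: contraNeq nz_k => nz_tr.
have: \tr (s *m A *m invmx s) = \tr A by rewrite mxtrace_mulC mulKmx.
rewrite (tw_s k) // -scalemxAl mulmxK // mxtraceZ -[RHS]mul1r => /(mulIf nz_tr).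
by move/eqP; rewrite pexprz_eq1 ?ler0n // pnatr_eq1 orbF.
Qed.

(** Comparing the determinants of [A] and [2 ^ k A], which are conjugate, gives
    [2 ^ (k N) = 1]. *)
Lemma unit_homogeneous k A : (0 < N)%N -> A \in G k -> A \in unitmx -> k = 0.
Proof.
move=> N_gt0 GA UA; have [s Us tw_s] := exists_twist assocG two_neq0.
have nz_det : \det (A *m s) != 0 by rewrite -unitfE -unitmxE unitmx_mul UA.
have := congr1 determinant (tw_s k A GA).
rewrite detZ !det_mulmx mulrC -det_mulmx -[LHS]mul1r => /(mulIf nz_det)/esym/eqP.
rewrite pexpr_eq1 ?exprz_ge0 ?ler0n // pexprz_eq1 ?ler0n //.
by rewrite pnatr_eq1 orbF => /eqP.
Qed.

(** Each nonzero homogeneous component of [s] is again a twist, hence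
    invertible, hence of degree 0. *)
Lemma twists_degree0 w s : twists G w s -> s \in G 0.
Proof.
move=> tw_s; have [S [p pG]] := exists_graded_projections (proj1 assocG).
apply: (mem_degree_eq0 pG (memvf s)) => k; apply: contraNeq => nz_pks.
have [N0|N_gt0] := posnP N.
  by case/eqP: nz_pks; apply/matrixP=> i; have := ltn_ord i; rewrite {2}N0.
apply/eqP; apply: unit_homogeneous (proj_mem pG k s) _ => //.
exact: twists_unit (proj_twists k pG tw_s) nz_pks.
Qed.

(** The twist [s] for a square root [im] of -1 satisfies [s e = - e s], because
    [e] has degree 2.  Multiplication by [s] carries a component of negative
    degree of [A] to a matrix of the same degree commuting with [e], which is
    therefore 0. *)
Lemma anticommutant_nonneg (im : F) (e A : 'M[F]_N) :
    im ^+ 2 = -1 -> e \in G 2 ->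
    (forall y, gl_bracket e y = 0 -> mem_sum_deg G (fun j => 0 <= j) y) ->
  e *m A + A *m e = 0 -> mem_sum_deg G (fun j => 0 <= j) A.
Proof.
move=> im2 Ge centG anti; have [decG mulG] := assocG.
have [S [p pG]] := exists_graded_projections decG.
have nz_im : im != 0.
  by apply: contra_eqN im2 => /eqP->; rewrite expr0n eq_sym oppr_eq0 oner_eq0.
have [s Us tw_s] := exists_twist assocG nz_im.
have Gs := twists_degree0 tw_s.
have se : s *m e = - (e *m s) by rewrite (tw_s 2) // [im ^ 2]im2 scaleN1r.
apply/(mem_sum_degP pG _ (memvf A)) => k k_lt0.
have pe : p (2 + k) (e *m A + A *m e) = e *m p k A + p k A *m e.
  have fG j B : B \in G j -> (mulmx e \+ mulmxr e) B \in G (2 + j).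
    by move=> GB /=; apply: rpredD; [|rewrite addrC]; apply: mulG.
  exact: (proj_homogeneous k pG pG fG (memvf A)).
have anti_k : e *m p k A = - (p k A *m e).
  by apply/eqP; rewrite -addr_eq0 -pe anti linear0.
have sA0 : s *m p k A = 0.
  have /(mem_sum_degP pG _ (memvf _)) cent0 :
      mem_sum_deg G (fun j => 0 <= j) (s *m p k A).
    apply: centG; rewrite /gl_bracket mulmxA -[e *m s]opprK -se.
    by rewrite mulNmx -!mulmxA anti_k mulmxN opprK subrr.
  have G_sA : s *m p k A \in G k.
    by rewrite -[in G k](add0r k) mulG ?(proj_mem pG).
  by rewrite -(proj_id pG G_sA) cent0.
by rewrite -[LHS](mulKmx Us) sA0 mulmx0.
Qed.

End AssociativeGradingsInCharacteristicZero.

(** * Coordinates on q(N) *)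

Section QueerCoordinates.
Variables (F : fieldType) (N : nat).
Implicit Types (A B C : 'M[F]_N) (x y E : 'M[F]_(N + N)) (b : bool).

(** As for [parity_part], the value [true] of [b] stands for odd. *)
Definition gl_embed b A : 'M[F]_(N + N) :=
  if b then block_mx 0 A A 0 else block_mx A 0 0 A.

Fact gl_embed_is_linear b : linear (gl_embed b).
Proof.
move=> a A B; rewrite /gl_embed.
by case: b; rewrite scale_block_mx add_block_mx !scaler0 !addr0.
Qed.

HB.instance Definition _ b :=
  GRing.isLinear.Build F 'M[F]_N 'M[F]_(N + N) _ (gl_embed b)
    (gl_embed_is_linear b).

Definition gl_coord b x : 'M[F]_N := if b then ursubmx x else ulsubmx x.

Fact gl_coord_is_linear b : linear (gl_coord b).
Proof. by case: b => a x y; apply/matrixP=> i j; rewrite !mxE. Qed.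

HB.instance Definition _ b :=
  GRing.isLinear.Build F 'M[F]_(N + N) 'M[F]_N _ (gl_coord b)
    (gl_coord_is_linear b).

Lemma gl_embedK b : cancel (gl_embed b) (gl_coord b).
Proof. by case: b => A; rewrite /gl_coord /= (block_mxKur, block_mxKul). Qed.

Lemma gl_coord_add b A A' :
  gl_coord b (gl_embed false A + gl_embed true A') = if b then A' else A.
Proof.
rewrite /gl_coord /gl_embed add_block_mx addr0 add0r.
by case: b; rewrite (block_mxKur, block_mxKul).
Qed.

Lemma gl_embed_queer b A : gl_embed b A \in queer F N.
Proof.
by apply/mem_queerP; case: b; [exists 0, A | exists A, 0].
Qed.

Lemma queer_coordE x : x \in queer F N ->
  x = gl_embed false (gl_coord false x) + gl_embed true (gl_coord true x).
Proof.
case/mem_queerP=> S [S' ->]; rewrite /gl_embed /gl_coord /=.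
by rewrite block_mxKul block_mxKur add_block_mx !addr0 !add0r.
Qed.

Lemma superbracketE A A' B B' :
  superbracket (gl_embed false A + gl_embed true A')
               (gl_embed false B + gl_embed true B')
  = gl_embed false (gl_bracket A B + (A' *m B' + B' *m A'))
    + gl_embed true (gl_bracket A B' + gl_bracket A' B).
Proof.
rewrite /superbracket !big_bool /parity_part /gl_embed /gl_bracket.
rewrite !(block_mxKul, block_mxKur, block_mxKdl, block_mxKdr, add_block_mx,
          addr0, add0r, mulmx_block, mulmx0, mul0mx, expr0, expr1, scale1r,
          scaleN1r, opprK, opp_block_mx, oppr0) /=.
by rewrite !add_block_mx !(addr0, add0r); congr block_mx; apply: addrC.
Qed.

Lemma represents_trace E (chi : {scalar 'M[F]_N}) A :
  represents E chi -> chi A = \tr (queer_S (parity_swap E) *m A).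
Proof.
case=> /mem_queer_oddP[e ->] chiE.
have := chiE (gl_embed false A) (gl_embed_queer _ _).
rewrite /chi_ext /queer_form /otr /queer_S /parity_swap /gl_embed.
by rewrite mulmx_block !(block_mxKul, block_mxKur) mul0mx add0r => ->.
Qed.

End QueerCoordinates.

(** * Gradings of q(N) *)

Section QueerGradings.
Variables (F : numFieldType) (N : nat) (G : int -> {vspace 'M[F]_(N + N)}).
Hypothesis gradG : queer_grading G.

Definition parity_component b j : {vspace 'M[F]_N} :=
  (linfun (gl_embed b) @^-1: G j)%VS.

Lemma mem_parity_component b j A :
  (A \in parity_component b j) = (gl_embed b A \in G j).
Proof. by rewrite -memv_preim lfunE. Qed.

Lemma even_restrictionE j : even_restriction G j = parity_component false j.
Proof.
apply/vspaceP=> A.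
by rewrite mem_even_restriction mem_parity_component.
Qed.

Lemma gl_coord_mem b j x : x \in G j -> gl_coord b x \in parity_component b j.
Proof.
rewrite mem_parity_component; case: gradG => _ /(_ j) {1}-> /memv_addP[u].
rewrite memv_cap => /andP[Gu /mem_queer_evenP[A def_u]] [v].
rewrite memv_cap => /andP[Gv /mem_queer_oddP[B def_v]] ->.
have ->: u + v = gl_embed false A + gl_embed true B by rewrite def_u def_v.
by rewrite gl_coord_add; case: b; rewrite /gl_embed -?def_u -?def_v.
Qed.

Lemma parity_component_decomposition b :
  direct_decomposition fullv (parity_component b).
Proof.
have [[[_ decG indG] _] _] := gradG.
split=> [j|A _|s u Us Gu sum_u0 j sj]; first exact: subvf.
  rewrite -(gl_embedK b A); apply: mem_sum_deg_map (decG _ (gl_embed_queer b A)).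
  by move=> j x; apply: gl_coord_mem.
apply: (can_inj (gl_embedK b)); rewrite linear0.
apply: (indG s (gl_embed b \o u)) sj => //= [k|].
  by rewrite -mem_parity_component.
by rewrite -linear_sum sum_u0 linear0.
Qed.

Let even_projections :=
  exists_graded_projections (parity_component_decomposition false).
Let odd_projections :=
  exists_graded_projections (parity_component_decomposition true).

Lemma gl_bracket_component b i j A B :
    A \in parity_component false i -> B \in parity_component b j ->
  gl_bracket A B \in parity_component b (i + j).
Proof.
rewrite !mem_parity_component => GA GB; have [[_ brG] _] := gradG.
have := brG i j _ _ GA GB; case: b GB => _.
  have := superbracketE A 0 0 B.
  rewrite /gl_bracket !linear0 !(mulmx0, mul0mx) subrr !addr0 !add0r linear0.
  by rewrite add0r => ->.
have := superbracketE A 0 B 0.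
rewrite /gl_bracket !linear0 !(mulmx0, mul0mx) !subrr !addr0 linear0 addr0.
by move=> ->.
Qed.

Lemma anticommutator_component i j A B :
    A \in parity_component true i -> B \in parity_component true j ->
  A *m B + B *m A \in parity_component false (i + j).
Proof.
rewrite !mem_parity_component => GA GB; have [[_ brG] _] := gradG.
have := brG i j _ _ GA GB; have := superbracketE 0 A 0 B.
rewrite /gl_bracket !linear0 !(mulmx0, mul0mx) !subrr !addr0 !add0r linear0.
by rewrite addr0 => ->.
Qed.

Lemma even_zgrading : zgrading (@gl_bracket F N) fullv (parity_component false).
Proof.
split; first exact: parity_component_decomposition.
by move=> i j A B; apply: gl_bracket_component.
Qed.

Hypothesis center0 : 1%:M \in parity_component false 0.

(** The odd identity [1'] commutes with the even part, so its homogeneous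
    components do too and are scalar multiples of [1']; hence [1'] has some
    degree [k].  As [[1', 1'] = 2] lies in degree [2 k] and in degree 0, this
    [k] is 0. *)
Lemma odd_identity_degree0 : 1%:M \in parity_component true 0.
Proof.
have [eq10|nz1] := eqVneq (1%:M : 'M[F]_N) 0; first by rewrite eq10 mem0v.
have [S [p pG]] := odd_projections.
have scalar_p k : exists a, p k 1%:M = a%:M.
  apply: commutes_scalar => B; apply/eqP; rewrite eq_sym -subr_eq0; apply/eqP.
  have [T [q qG]] := even_projections.
  rewrite (sum_proj qG (memvf B)) mulmx_suml mulmx_sumr -sumrB big1 // => i _.
  have Gq := proj_mem qG i B.
  have ad_q j C : C \in parity_component true j ->
      (mulmx (q i B) \- mulmxr (q i B)) C \in parity_component true (i + j).
    exact: gl_bracket_component.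
  rewrite -[LHS](proj_homogeneous k pG pG ad_q (memvf _)) /=.
  by rewrite mulmx1 mul1mx subrr linear0.
have [k nz_pk]: exists k, p k 1%:M != 0.
  have [/allP p0|/allPn[k _ nz_pk]] := boolP (all (fun k => p k 1%:M == 0) S).
    case/eqP: nz1; rewrite (sum_proj pG (memvf 1%:M)) big1_seq // => k /p0.
    exact: eqP.
  by exists k.
have Gk1 : 1%:M \in parity_component true k.
  have [a def_p] := scalar_p k; have nz_a : a != 0.
    by apply: contraNneq nz_pk => a0; rewrite def_p a0 raddf0.
  have := proj_mem pG k 1%:M; rewrite def_p -[a%:M]scalemx1 => /(memvZ a^-1).
  by rewrite scalerA mulVf // scale1r.
have := anticommutator_component Gk1 Gk1; rewrite mulmx1 -mulr2n -scaler_nat.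
move/(memvZ 2^-1); rewrite scalerA mulVf ?pnatr_eq0 // scale1r => G2k1.
have [T [q qG]] := even_projections.
move/esym/eqP: (graded_disjoint qG center0 G2k1 nz1).
by rewrite -mulr2n mulrn_eq0 /= => /eqP k0; rewrite k0 in Gk1.
Qed.

(** The bracket with the odd identity doubles [A] and changes its parity. *)
Lemma odd_even_component A j :
  A \in parity_component true j -> A \in parity_component false j.
Proof.
move/(anticommutator_component odd_identity_degree0).
rewrite add0r mul1mx mulmx1 -mulr2n -scaler_nat => /(memvZ 2^-1).
by rewrite scalerA mulVf ?pnatr_eq0 // scale1r.
Qed.

(** The components of [A] for the odd grading are, by [odd_even_component], also
    its components for the even grading, where only one of them is nonzero. *)
Lemma even_odd_component A j :
  A \in parity_component false j -> A \in parity_component true j.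
Proof.
move=> GA; have [S [p pG]] := odd_projections.
have [T [q qG]] := even_projections.
apply: (mem_degree_eq0 pG (memvf A)) => k neq_kj.
rewrite -(proj_neq qG GA neq_kj).
have id0 i B : B \in parity_component true i ->
    idfun B \in parity_component false (0 + i).
  by rewrite add0r; apply: odd_even_component.
by have := proj_homogeneous k pG qG id0 (memvf A); rewrite add0r /= => ->.
Qed.

(** The even bracket [AB - BA] and the odd one [AB + BA] add up to [2 AB]. *)
Lemma even_associative_grading : associative_grading (parity_component false).
Proof.
split=> [|i j A B GA GB]; first exact: parity_component_decomposition.
have := memvD (gl_bracket_component GA GB)
  (anticommutator_component (even_odd_component GA) (even_odd_component GB)).
rewrite /gl_bracket addrACA addNr addr0 -mulr2n -scaler_nat => /(memvZ 2^-1).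
by rewrite scalerA mulVf ?pnatr_eq0 // scale1r.
Qed.

End QueerGradings.

(** * Good gradings *)

(** Families of subspaces equal degree by degree need not be equal as functions,
    so the transfer is spelled out instead of rewritten. *)
Lemma eq_gl_good_grading (F : fieldType) (N : nat) (e : 'M[F]_N)
    (G H : int -> {vspace 'M[F]_N}) :
  G =1 H -> gl_good_grading e G -> gl_good_grading e H.
Proof.
move=> eqGH [[[sG decG indG] brG] centerG Ge centG].
have GH P x : mem_sum_deg G P x -> mem_sum_deg H P x.
  by apply: (mem_sum_deg_map (f := idfun)) => j y; rewrite eqGH.
split=> [|z /centerG||y /centG/GH//]; rewrite -?eqGH //.
split=> [|i j x y]; last by rewrite -!eqGH; apply: brG.
split=> [j|x /decG/GH//|s u Us Hu]; first by rewrite -eqGH.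
by apply: indG => // j; rewrite eqGH.
Qed.

Section GoodGradings.
Variables (F : numFieldType) (N : nat).
Variables (chi : {scalar 'M[F]_N}) (E : 'M[F]_(N + N)).
Hypothesis chiE : represents E chi.
Variable G : int -> {vspace 'M[F]_(N + N)}.
Hypothesis gradG : queer_grading G.

Local Notation e := (queer_S (parity_swap E)).
Local Notation G0 := (parity_component G false).
Local Notation nonneg := (fun j : int => 0 <= j).

(** The bracket of the odd part [A'] with the odd identity is [2 A'], so the
    center is even. *)
Lemma queer_center_even z : in_center (@superbracket F N) (queer F N) z ->
  exists2 A, z = gl_embed false A & in_center (@gl_bracket F N) fullv A.
Proof.
case=> /queer_coordE-> central.
set A := gl_coord false z; set A' := gl_coord true z.
have br B B' : gl_bracket A B + (A' *m B' + B' *m A') = 0.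
  have gB : gl_embed false B + gl_embed true B' \in queer F N.
    by rewrite rpredD ?gl_embed_queer.
  have := central _ gB; rewrite superbracketE.
  by move/(congr1 (gl_coord false)); rewrite gl_coord_add linear0.
have A'0 : A' = 0.
  have := br 0 1%:M; rewrite /gl_bracket mulmx0 mul0mx subrr add0r mulmx1 mul1mx.
  by move/eqP; rewrite -mulr2n -scaler_nat scaler_eq0 pnatr_eq0 => /eqP.
exists A; first by rewrite A'0 linear0 addr0.
split=> [|B _]; first exact: memvf.
by have := br B 0; rewrite mulmx0 mul0mx !addr0.
Qed.

Lemma scalar_queer_center :
  in_center (@superbracket F N) (queer F N) (gl_embed false 1%:M).
Proof.
split=> [|x /queer_coordE->]; first exact: gl_embed_queer.
have:= superbracketE 1%:M 0 (gl_coord false x) (gl_coord true x).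
rewrite /gl_bracket !(mulmx1, mul1mx, mul0mx, mulmx0, subrr, addr0, linear0).
by [].
Qed.

(** By invariance of the trace,
    [chi [y, x] = tr ([e, A] B) + tr ((e A' + A' e) B')]
    where [A], [A'] and [B], [B'] are the coordinates of [y] and [x]. *)
Lemma stabilizerP y : y \in queer F N ->
  stabilizer chi y <->
    gl_bracket e (gl_coord false y) = 0
    /\ e *m gl_coord true y + gl_coord true y *m e = 0.
Proof.
move=> gy; set A := gl_coord false y; set A' := gl_coord true y.
have chi_br B B' :
    chi_ext chi (superbracket y (gl_embed false B + gl_embed true B'))
    = \tr (gl_bracket e A *m B) + \tr ((e *m A' + A' *m e) *m B').
  rewrite [y](queer_coordE gy) superbracketE /chi_ext.
  rewrite -[queer_S _]/(gl_coord false _) gl_coord_add.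
  rewrite (represents_trace _ chiE) mulmxDr linearD /=; congr (_ + _).
    rewrite /gl_bracket mulmxBr mulmxBl !linearB /= !mulmxA; congr (_ - _).
    by rewrite mxtrace_mulC mulmxA.
  rewrite mulmxDr mulmxDl !linearD /= !mulmxA; congr (_ + _).
  by rewrite mxtrace_mulC mulmxA.
split=> [[_ chi0]|[eA0 eA'0]]; last first.
  split=> // x /queer_coordE->.
  by rewrite chi_br eA0 eA'0 !mul0mx !linear0 addr0.
split; apply: mxtrace_nondegenerate => B.
  have := chi_br B 0; rewrite mulmx0 mxtrace0 addr0 => <-.
  by rewrite chi0 // rpredD ?gl_embed_queer.
have := chi_br 0 B; rewrite mulmx0 mxtrace0 add0r => <-.
by rewrite chi0 // rpredD ?gl_embed_queer.
Qed.

(** That [e] has degree 2 is read off from the trace form: the component of [e]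
    of degree [k] can only pair with degree [- k], where it pairs as [e] itself
    does, that is trivially unless [k = 2]. *)
Lemma good_grading_even : queer_good_grading chi G -> gl_good_grading e G0.
Proof.
case=> _ centerG chiG stabG.
have center0 : 1%:M \in G0 0.
  by rewrite mem_parity_component; apply/centerG/scalar_queer_center.
have assocG := even_associative_grading gradG center0.
have [decG mulG] := assocG.
have [S [p pG]] := exists_graded_projections decG.
have trace_e j A : A \in G0 j -> j != - 2 -> \tr (e *m A) = 0.
  rewrite mem_parity_component => GA /chiG/(_ _ GA).
  by rewrite -(represents_trace _ chiE) /chi_ext [queer_S _]block_mxKul.
split=> [|z [_ central]||y ey0]; first exact: even_zgrading.
- have [a ->]: exists a, z = a%:M.
    apply: commutes_scalar => B; apply/eqP; rewrite -subr_eq0; apply/eqP.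
    exact/central/memvf.
  by rewrite -scalemx1 memvZ.
- apply: (mem_degree_eq0 pG (memvf e)) => k neq_k2.
  apply: mxtrace_nondegenerate => A; rewrite (sum_proj pG (memvf A)).
  rewrite mulmx_sumr linear_sum big1 //= => j _; have Gj := proj_mem pG j A.
  have Gk i := proj_mem pG i e.
  have [sum0|nz_sum] := eqVneq (k + j) 0; last first.
    by rewrite (mxtrace_homogeneous assocG (mulG _ _ _ _ (Gk k) Gj)).
  have def_j : j = - k by apply/eqP; rewrite -addr_eq0 addrC sum0.
  have: \tr (e *m p j A) = 0.
    by apply: trace_e Gj _; rewrite def_j eqr_opp.
  have Gek : e - p k e \in fullv by apply: memvf.
  rewrite -{1}(subrK (p k e) e) mulmxDl linearD /=.
  rewrite (sum_proj pG Gek) mulmx_suml linear_sum big1 ?add0r //= => i _.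
  have [->|neq_ik] := eqVneq i k.
    by rewrite linearB /= (proj_id pG (Gk k)) subrr mul0mx linear0.
  rewrite (mxtrace_homogeneous assocG (mulG _ _ _ _ (proj_mem pG i _) Gj)) //.
  by rewrite def_j subr_eq0.
rewrite -(gl_embedK false y).
apply: (mem_sum_deg_map (gl_coord_mem gradG false)); apply: stabG.
apply/stabilizerP; rewrite ?gl_embed_queer // gl_embedK.
by rewrite [gl_coord true _]block_mxKur mulmx0 mul0mx addr0.
Qed.

(** The even part of the stabilizer is the centralizer of [e]; its odd part is
    handled by [anticommutant_nonneg]. *)
Lemma good_grading_queer (im : F) : im ^+ 2 = -1 ->
  gl_good_grading e G0 -> queer_good_grading chi G.
Proof.
move=> im2 [_ centerG Ge centG].
have center0 : 1%:M \in G0 0.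
  apply: centerG; split=> [|B _]; first exact: memvf.
  by rewrite /gl_bracket mulmx1 mul1mx subrr.
have assocG := even_associative_grading gradG center0.
have [decG mulG] := assocG.
have [[decQ _] _] := gradG.
split=> // [z /queer_center_even[A -> /centerG]|j neq_j2 x Gx|y stab_y].
- by rewrite mem_parity_component.
- have G0x : gl_coord false x \in G0 j by apply: gl_coord_mem.
  rewrite /chi_ext (represents_trace _ chiE).
  rewrite (mxtrace_homogeneous assocG (mulG _ _ _ _ Ge G0x)) //.
  by rewrite addrC addr_eq0.
have gy : y \in queer F N by case: stab_y.
have [/centG deg_even anti] := (stabilizerP gy).1 stab_y.
have deg_odd := anticommutant_nonneg assocG im2 Ge centG anti.
rewrite (queer_coordE gy).
apply: mem_sum_degD decQ _ _ _ _; try exact: gl_embed_queer.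
  by apply: (mem_sum_deg_map _ deg_even) => j A; rewrite mem_parity_component.
apply: (mem_sum_deg_map _ deg_odd) => j A /(even_odd_component gradG center0).
by rewrite mem_parity_component.
Qed.

End GoodGradings.

Theorem lemma2p2 (R : realType) (N : nat)
    (chi : {scalar 'M[R[i]]_N}) (hchi : nilpotent_functional chi)
    (E : 'M[R[i]]_(N + N)) (hE : represents E chi)
    (G : int -> {vspace 'M[R[i]]_(N + N)}) (hG : queer_grading G) :
  let e := queer_S (parity_swap E) in
  queer_good_grading chi G <-> gl_good_grading e (even_restriction G).
Proof.
split=> [goodG | good0].
  apply: eq_gl_good_grading (good_grading_even hE hG goodG) => j.
  by rewrite even_restrictionE.
apply: (good_grading_queer hE hG (sqr_i R)).
by apply: eq_gl_good_grading good0 => j; rewrite even_restrictionE.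
Qed.
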